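(* Let $V$ be a finite dimensional real vector space with a non-degenerate symmetric bilinear form $(\cdot,\cdot)$ of signature $(p,q)$, and let $J$ be a pseudo-Hermitian almost complex structure on $V$. Let $\phi:V\to V$ be a linear map such that $\phi^*=\varepsilon\phi$ and $J\phi=\varrho\phi J$, where $\varepsilon=\pm1$ and $\varrho=\pm1$. Then $R_\phi$ is an almost complex algebraic curvature tensor.
   Context: The adjoint $\phi^*$ of a linear map $\phi$ of $V$ is defined by $(\phi v,w)=(v,\phi^*w)$ for all $v,w\in V$; $\phi$ is self-adjoint if $\phi^*=\phi$ and skew-adjoint if $\phi^*=-\phi$. If $\phi$ is self-adjoint, define $R_\phi(x,y,z,w):=(\phi y,z)(\phi x,w)-(\phi x,z)(\phi y,w)$. If $\phi$ is skew-adjoint, define $R_\phi(x,y,z,w):=(\phi y,z)(\phi x,w)-(\phi x,z)(\phi y,w)-2(\phi x,y)(\phi z,w)$. A 4-tensor $R$ (a multilinear map $R:V^4\to\mathbb{R}$) is an algebraic curvature tensor if for all $x,y,z,w\in V$: $R(x,y,z,w)=-R(y,x,z,w)$; $R(x,y,z,w)=R(z,w,x,y)$; and $R(x,y,z,w)+R(y,z,x,w)+R(z,x,y,w)=0$. The associated curvature operator $R(x,y):V\to V$ is the linear map defined by $(R(x,y)z,w)=R(x,y,z,w)$. A 2-plane $\pi\subset V$ is non-degenerate if the restriction of $(\cdot,\cdot)$ to $\pi$ is non-degenerate. If $\{x,y\}$ is an oriented basis of a non-degenerate oriented 2-plane $\pi$, the skew-symmetric curvature operator is $R(\pi):=|(x,x)(y,y)-(x,y)^2|^{-1/2}R(x,y)$.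 A pseudo-Hermitian almost complex structure $J$ on $V$ is a linear isometry of $(V,(\cdot,\cdot))$ with $J^2=-\mathrm{Id}$. A 2-plane $\pi$ is a complex line if $J\pi=\pi$; complex lines are oriented by bases of the form $\{x,Jx\}$. An algebraic curvature tensor $R$ is almost complex if $JR(\pi)=R(\pi)J$ for every non-degenerate complex line $\pi$. *)

(* Defs.v *)
From HB Require Import structures.
From mathcomp Require Import all_boot all_order all_algebra.
From mathcomp Require Import boolp classical_sets reals.

Set Implicit Arguments.
Unset Strict Implicit.
Unset Printing Implicit Defensive.

Import Order.TTheory GRing.Theory Num.Theory.
Local Open Scope classical_set_scope.
Local Open Scope ring_scope.

Section Forms.
Context {R : realType} {V : vectType R}.
Implicit Types (g : {symmetric V}) (phi psi J A : 'End(V)) (pi W : {vspace V}).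

Definition negative_definite_on g W :=
  forall x, x \in W -> x != 0 -> g x x < 0.

Definition positive_definite_on g W :=
  forall x, x \in W -> x != 0 -> 0 < g x x.

Definition max_dim (P : {vspace V} -> Prop) (n : nat) :=
  (exists2 W, P W & \dim W = n) /\ forall W, P W -> (\dim W <= n)%N.

(* p counts the timelike (negative) directions, q the spacelike ones. *)
Definition has_signature g (p q : nat) :=
  max_dim (negative_definite_on g) p /\ max_dim (positive_definite_on g) q.

(* The psi with (phi v, w) = (v, psi w): see adjointP and adjoint_unique; the
   default 0 is irrelevant when g is nondegenerate. *)
Definition adjoint g phi : 'End(V) :=
  xget 0 [set psi : 'End(V) | forall v w, g (phi v) w = g v (psi w)].

Definition self_adjoint g phi := adjoint g phi = phi.
Definition skew_adjoint g phi := adjoint g phi = - phi.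

Definition tensor4 := V -> V -> V -> V -> R.

Definition multilinear4 (T : tensor4) :=
  [/\ forall y z w, scalar (fun x => T x y z w),
      forall x z w, scalar (fun y => T x y z w),
      forall x y w, scalar (fun z => T x y z w) &
      forall x y z, scalar (fun w => T x y z w)].

Definition algebraic_curvature_tensor (T : tensor4) :=
  [/\ multilinear4 T,
      forall x y z w, T x y z w = - T y x z w,
      forall x y z w, T x y z w = T z w x y &
      forall x y z w, T x y z w + T y z x w + T z x y w = 0].

Definition self_adjoint_curvature g phi : tensor4 := fun x y z w =>
  g (phi y) z * g (phi x) w - g (phi x) z * g (phi y) w.

Definition skew_adjoint_curvature g phi : tensor4 := fun x y z w =>
  g (phi y) z * g (phi x) w - g (phi x) z * g (phi y) w
  - 2 * g (phi x) y * g (phi z) w.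

(* The two cases overlap only at phi = 0, where both formulas vanish. A phi
   that is neither self- nor skew-adjoint gets the junk value 0. *)
Definition curvature_of g phi : tensor4 :=
  if `[< self_adjoint g phi >] then self_adjoint_curvature g phi
  else if `[< skew_adjoint g phi >] then skew_adjoint_curvature g phi
  else fun _ _ _ _ => 0.

(* The linear map A with (A z, w) = T x y z w; see curvature_operatorP. *)
Definition curvature_operator g (T : tensor4) (x y : V) : 'End(V) :=
  xget 0 [set A : 'End(V) | forall z w, g (A z) w = T x y z w].

(* R(pi) for the oriented plane pi with oriented basis {x, y}. *)
Definition skew_curvature_operator g (T : tensor4) (x y : V) : 'End(V) :=
  (Num.sqrt `|g x x * g y y - g x y ^+ 2|)^-1 *: curvature_operator g T x y.

Definition pseudo_hermitian g J :=
  isometry g g J /\ (J \o J)%VF = - \1%VF.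

Definition nondegenerate_plane g pi :=
  \dim pi = 2 /\
  forall x, x \in pi -> (forall y, y \in pi -> g x y = 0) -> x = 0.

Definition complex_line J pi := \dim pi = 2 /\ (J @: pi)%VS = pi.

(* Complex lines are oriented by the bases {x, J x}; all of them induce the
   same orientation, and each is allowed to represent R(pi). *)
Definition almost_complex g J (T : tensor4) :=
  forall pi, complex_line J pi -> nondegenerate_plane g pi ->
  forall x, basis_of pi [:: x; J x] ->
  (J \o skew_curvature_operator g T x (J x))%VF
  = (skew_curvature_operator g T x (J x) \o J)%VF.

Lemma nondegenerate_inj g : nondegenerate g ->
  forall u v, (forall w, g u w = g v w) -> u = v.
Proof.
move=> /eqP g0 u v uv; apply/eqP; rewrite -subr_eq0 -memv0 -g0.
by apply/mem_orthovP => w _; rewrite linearBl /= uv subrr.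
Qed.

Lemma nondegenerate_represents g : nondegenerate g ->
  forall T : V -> V -> R,
  (forall w, scalar (fun z => T z w)) -> (forall z, scalar (T z)) ->
  exists A : 'End(V), forall z w, g (A z) w = T z w.
Proof.
move=> g0 T Tl Tr; pose e := vbasis {:V}.
pose row (S : V -> V -> R) z := \row_(i < \dim {:V}) S z e`_i.
have row_lin S : (forall w, scalar (fun z => S z w)) -> linear (row S).
  by move=> Sl a u v; apply/rowP => i; rewrite !mxE Sl.
have row_inj (f h : V -> R) : scalar f -> scalar h ->
    \row_(i < \dim {:V}) f e`_i = \row_(i < \dim {:V}) h e`_i -> f =1 h.
  move=> fl hl fh w.
  pose F : {linear V -> R^o} := HB.pack f (GRing.isLinear.Build _ _ _ _ f fl).
  pose H : {linear V -> R^o} := HB.pack h (GRing.isLinear.Build _ _ _ _ h hl).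
  rewrite -[f]/(F : V -> R^o) -[h]/(H : V -> R^o).
  rewrite (coord_vbasis (memvf w)) !linear_sum; apply: eq_bigr => i _.
  have /rowP/(_ i) := fh; rewrite !mxE => fhi.
  by rewrite !linearZ /= -[LHS]/(_ * f _) fhi.
have gl w : scalar (fun z => g z w) by move=> a u v; rewrite linearPl.
have gr z : scalar (g z) by move=> a u v; rewrite linearPr.
pose G : {linear V -> 'rV[R]_(\dim {:V})} :=
  HB.pack (row g) (GRing.isLinear.Build _ _ _ _ (row g) (row_lin _ gl)).
pose H : {linear V -> 'rV[R]_(\dim {:V})} :=
  HB.pack (row T) (GRing.isLinear.Build _ _ _ _ (row T) (row_lin _ Tl)).
have ker0 : lker (linfun G) == 0%VS.
  apply/lker0P => u v; rewrite !lfunE => uv.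
  by apply: (nondegenerate_inj g0); apply: row_inj.
have im : limg (linfun G) = fullv.
  apply/eqP; rewrite eqEdim subvf /= limg_dim_eq.
    by rewrite !dimvf /dim /= mul1n.
  by rewrite (eqP ker0) capv0.
exists ((linfun G)^-1 \o linfun H)%VF => z; apply: row_inj => //.
rewrite comp_lfunE lfunE -[LHS]/(G _) -[LHS]lfunE.
by rewrite limg_lfunVK // im memvf.
Qed.

Lemma adjointP g phi : nondegenerate g ->
  forall v w, g (phi v) w = g v (adjoint g phi w).
Proof.
move=> g0; rewrite /adjoint; apply: (@xgetPex _ 0 [set psi : 'End(V) |
  forall v w, g (phi v) w = g v (psi w)]).
have [||psi psiE] := nondegenerate_represents g0 (T := fun w v => g (phi v) w).
- by move=> w a u v; rewrite linearPr.
- by move=> z a u v; rewrite linearP linearPl.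
by exists psi => v w; rewrite -psiE hermC expr0 mul1r.
Qed.

Lemma adjoint_unique g phi psi : nondegenerate g ->
  (forall v w, g (phi v) w = g v (psi w)) -> adjoint g phi = psi.
Proof.
move=> g0 psiE; apply/lfunP => w; apply: (nondegenerate_inj g0) => v.
rewrite hermC [RHS]hermC /= !expr0 !mul1r.
by rewrite -adjointP // psiE.
Qed.

Lemma curvature_operatorP g T : nondegenerate g -> multilinear4 T ->
  forall x y z w, g (curvature_operator g T x y z) w = T x y z w.
Proof.
move=> g0 [_ _ T3 T4] x y.
apply: (@xgetPex _ 0 [set A : 'End(V) | forall z w, g (A z) w = T x y z w]).
exact: nondegenerate_represents.
Qed.

End Forms.

(* Main.v *)
(* As J is skew-adjoint, R(x, J x) commutes with J as soon as
   R(x, J x, J z, w) = - R(x, J x, z, J w). Moving every J out of phi with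
   (phi J x, y) = - rho (phi x, J y) makes this an identity of polynomials,
   except for the last term of R_phi in the skew-adjoint case, where one also
   needs rho (phi x, J x) = (phi x, J x). *)

Require Import Defs.
From mathcomp Require Import all_boot all_order all_algebra reals.
From mathcomp Require Import boolp ring.

Import GRing.Theory.
Local Open Scope ring_scope.

Section Curvature.
Set Implicit Arguments.
Unset Strict Implicit.

Context {R : realType} {V : vectType R}.
Implicit Types (g : {symmetric V}) (phi J : 'End(V)) (T : @tensor4 R V).

Lemma symmetric_formC g x y : g x y = g y x.
Proof. by rewrite hermC expr0 mul1r. Qed.

Lemma self_adjointE g phi : nondegenerate g -> self_adjoint g phi ->
  forall x y, g (phi x) y = g (phi y) x.
Proof. by move=> g0 sa x y; rewrite adjointP // sa symmetric_formC. Qed.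

Lemma skew_adjointE g phi : nondegenerate g -> skew_adjoint g phi ->
  forall x y, g (phi x) y = - g (phi y) x.
Proof.
by move=> g0 sk x y; rewrite adjointP // sk opp_lfunE linearNr symmetric_formC.
Qed.

Lemma self_adjoint_curvature_algebraic g phi :
  nondegenerate g -> self_adjoint g phi ->
  algebraic_curvature_tensor (self_adjoint_curvature g phi).
Proof.
move=> g0 /(self_adjointE g0) phiC; rewrite /self_adjoint_curvature.
split; first by split=> [y z w|x z w|x y w|x y z] a u v;
  rewrite /= ?linearP ?linearPl ?linearPr /=; ring.
- by move=> x y z w; ring.
- move=> x y z w.
  by rewrite (phiC z) (phiC w) (phiC w y) (phiC z x); ring.
- move=> x y z w.
  (* In the cyclic sum [g (phi x) w] has coefficient [g (phi y) z - g (phi z) y], which vanishes by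
     symmetry; the other two are its cyclic images. *)
  by rewrite (phiC z x) (phiC z y) (phiC y x); ring.
Qed.

Lemma skew_adjoint_curvature_algebraic g phi :
  nondegenerate g -> skew_adjoint g phi ->
  algebraic_curvature_tensor (skew_adjoint_curvature g phi).
Proof.
move=> g0 /(skew_adjointE g0) phiC; rewrite /skew_adjoint_curvature.
split; first by split=> [y z w|x z w|x y w|x y z] a u v;
  rewrite /= ?linearP ?linearPl ?linearPr /=; ring.
- by move=> x y z w; rewrite (phiC y x); ring.
- move=> x y z w.
  by rewrite (phiC z x) (phiC w x) (phiC w y) (phiC z y); ring.
- move=> x y z w.
  (* Here the first two terms give [g (phi x) w] the coefficient [2 * g (phi y) z], and the third
     term contributes its opposite. *)
  by rewrite (phiC z x) (phiC z y) (phiC y x); ring.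
Qed.

Lemma pseudo_hermitianK g J : pseudo_hermitian g J -> forall x, J (J x) = - x.
Proof.
by case=> _ /lfunP JJ x; have := JJ x; rewrite comp_lfunE opp_lfunE id_lfunE.
Qed.

(** The adjoint of an isometry is its inverse, and the inverse of [J] is [- J]. *)
Lemma pseudo_hermitian_skew g J : pseudo_hermitian g J ->
  forall x y, g (J x) y = - g x (J y).
Proof.
move=> hJ x y; have [iJ _] := hJ.
by rewrite -(iJ x (J y)) (pseudo_hermitianK hJ) linearNr opprK.
Qed.

Lemma almost_complex_skew g J T : nondegenerate g -> pseudo_hermitian g J ->
  multilinear4 T ->
  (forall x z w, T x (J x) (J z) w = - T x (J x) z (J w)) ->
  almost_complex g J T.
Proof.
move=> g0 hJ Tl TJ pi _ _ x _; apply/lfunP => z.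
rewrite /skew_curvature_operator !(comp_lfunE, scale_lfunE) linearZ /=.
(* The normalising factor is the same scalar on both sides, so it remains to compare the curvature
   operators. *)
congr (_ *: _); apply: (nondegenerate_inj g0) => w.
by rewrite (pseudo_hermitian_skew hJ) !curvature_operatorP.
Qed.

(** As [rho] is its own inverse, [phi (J x) = rho *: J (phi x)], and [J] is skew-adjoint. *)
Lemma form_phiJ g J phi rho : pseudo_hermitian g J ->
  rho = 1 \/ rho = -1 -> (J \o phi)%VF = rho *: (phi \o J)%VF ->
  forall x y, g (phi (J x)) y = - rho * g (phi x) (J y).
Proof.
move=> hJ rhoE /lfunP Jphi x y.
have := pseudo_hermitian_skew hJ (phi x) y.
have -> : J (phi x) = rho *: phi (J x).
  by have := Jphi x; rewrite scale_lfunE !comp_lfunE.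
rewrite linearZl_LR /=; case: rhoE => -> E; first by rewrite mulN1r -E mul1r.
by rewrite opprK mul1r -[RHS]opprK -E mulN1r opprK.
Qed.

Lemma self_adjoint_curvature_almost_complex g J phi rho :
  nondegenerate g -> pseudo_hermitian g J -> self_adjoint g phi ->
  rho = 1 \/ rho = -1 -> (J \o phi)%VF = rho *: (phi \o J)%VF ->
  almost_complex g J (self_adjoint_curvature g phi).
Proof.
move=> g0 hJ sa rhoE Jphi.
have [Tl _ _ _] := self_adjoint_curvature_algebraic g0 sa.
apply: almost_complex_skew => // x z w; rewrite /self_adjoint_curvature.
(* Both sides become [rho * (g (phi x) z * g (phi x) w + g (phi x) (J z) * g (phi x) (J w))]. *)
by rewrite !(form_phiJ hJ rhoE Jphi) !(pseudo_hermitianK hJ) !linearN /=; ring.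
Qed.

Lemma skew_adjoint_curvature_almost_complex g J phi rho :
  nondegenerate g -> pseudo_hermitian g J -> skew_adjoint g phi ->
  rho = 1 \/ rho = -1 -> (J \o phi)%VF = rho *: (phi \o J)%VF ->
  almost_complex g J (skew_adjoint_curvature g phi).
Proof.
move=> g0 hJ sk rhoE Jphi.
have [Tl _ _ _] := skew_adjoint_curvature_algebraic g0 sk.
have phiJ := form_phiJ hJ rhoE Jphi.
apply: almost_complex_skew => // x z w; rewrite /skew_adjoint_curvature.
(* For [rho = -1] this says that [g (phi x) (J x) = 0]. *)
have rho_phi : rho * g (phi x) (J x) = g (phi x) (J x).
  have := phiJ x x; rewrite (skew_adjointE g0 sk) mulNr.
  by move/oppr_inj => <-.
(* In the third term, the left side gets a factor [rho] from [phi (J z)]; occurrence 2 is on the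
   right side, which still lacks it. *)
rewrite !phiJ !(pseudo_hermitianK hJ) !linearN /= -{2}rho_phi; ring.
Qed.

End Curvature.

Theorem theorem2 (R : realType) (V : vectType R) (g : {symmetric V})
    (p q : nat) (J phi : 'End(V)) (eps rho : R) :
  nondegenerate g ->
  has_signature g p q ->
  pseudo_hermitian g J ->
  eps = 1 \/ eps = -1 ->
  rho = 1 \/ rho = -1 ->
  adjoint g phi = eps *: phi ->
  (J \o phi)%VF = rho *: (phi \o J)%VF ->
  algebraic_curvature_tensor (curvature_of g phi) /\
  almost_complex g J (curvature_of g phi).
Proof.
move=> g0 _ hJ epsE rhoE phiE Jphi; rewrite /curvature_of.
(* The split follows [curvature_of] and not [eps]: with [eps = -1], the map [phi = 0] still falls in
   the self-adjoint branch. *)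
case: asboolP => [sa|nsa].
  split; first exact: self_adjoint_curvature_algebraic.
  exact: self_adjoint_curvature_almost_complex rhoE Jphi.
have sk : skew_adjoint g phi.
  case: epsE phiE => -> phiE; last by rewrite /skew_adjoint phiE scaleN1r.
  by case: nsa; rewrite /self_adjoint phiE scale1r.
rewrite asboolT //; split; first exact: skew_adjoint_curvature_algebraic.
exact: skew_adjoint_curvature_almost_complex rhoE Jphi.
Qed.
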